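(* Let $n\ge 3$, $\mathbb K=\mathbb R$ or $\mathbb C$, and work in the formal, real analytic or holomorphic category. Let $f\in\mathcal F(\mathbb K^n)$ be a quasihomogeneous polynomial with $f(0)=0$ and of finite codimension. Let $\alpha\in\Omega^k(\mathbb K^n)$ with $2\le k\le n-1$ satisfy $d\alpha=0$ and $df\wedge\alpha=0$. Then there exists $\gamma\in\Omega^{k-2}(\mathbb K^n)$ such that $\alpha=df\wedge d\gamma$.
   Context: $\mathcal F(\mathbb K^n)$ and $\Omega^k(\mathbb K^n)$ denote the spaces of germs at $0\in\mathbb K^n$ of functions and of $k$-forms in the chosen category (formal power series over $\mathbb K$, resp. forms with formal power series coefficients, in the formal case; real analytic when $\mathbb K=\mathbb R$; holomorphic when $\mathbb K=\mathbb C$). $f$ is of finite codimension if $Q_f=\mathcal F(\mathbb K^n)/I_f$ is finite dimensional over $\mathbb K$, where $I_f$ is the ideal generated by $\frac{\partial f}{\partial x_1},\dots,\frac{\partial f}{\partial x_n}$. $f$ is quasihomogeneous (of degree $\mathrm N$) if there are positive integers $w_1,\dots,w_n$ such that, with $W=\sum_i w_ix_i\frac{\partial}{\partial x_i}$, one has $W.f=\mathrm N f$. *)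

(* Defs.v *)
From HB Require Import structures.
From mathcomp Require Import all_boot all_order all_algebra.
From mathcomp Require Import boolp reals complex.
From mathcomp Require Import mpoly.

Set Implicit Arguments.
Unset Strict Implicit.
Unset Printing Implicit Defensive.

Import Order.TTheory GRing.Theory Num.Theory.
Local Open Scope ring_scope.

Variant ground := real_ground | complex_ground.

Definition ground_field (R : realType) (b : ground) : numFieldType :=
  match b with real_ground => R | complex_ground => R[i] end.

(* The formal power series  \sum_m (a m) x^m  in  x_0, ..., x_(n-1),  encoded
   by its coefficient function  a. *)
Definition series (n : nat) (K : comNzRingType) : Type := 'X_{1..n} -> K.

Section SeriesRing.
Variables (n : nat) (K : comNzRingType).
Implicit Types (a b c : series n K) (m : 'X_{1..n}).

HB.instance Definition _ := gen_eqMixin (series n K).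
HB.instance Definition _ := gen_choiceMixin (series n K).

Definition series_zero : series n K := fun _ => 0.
Definition series_opp a : series n K := fun m => - a m.
Definition series_add a b : series n K := fun m => a m + b m.

Fact series_addA : associative series_add.
Proof. by move=> a b c; apply: funext => m; apply: addrA. Qed.
Fact series_addC : commutative series_add.
Proof. by move=> a b; apply: funext => m; apply: addrC. Qed.
Fact series_add0 : left_id series_zero series_add.
Proof. by move=> a; apply: funext => m; apply: add0r. Qed.
Fact series_addN : left_inverse series_zero series_opp series_add.
Proof. by move=> a; apply: funext => m; apply: addNr. Qed.

HB.instance Definition _ := GRing.isZmodule.Build (series n K)
  series_addA series_addC series_add0 series_addN.

Definition series_of_mpoly (p : {mpoly K[n]}) : series n K := fun m => p@_m.

(* The Cauchy product; the bounds on the degrees of k.1 and k.2 only make the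
   range of summation a finType. *)
Definition series_one : series n K := series_of_mpoly 1.
Definition series_mul a b : series n K := fun m =>
  \sum_(k : 'X_{1..n < (mdeg m).+1, (mdeg m).+1} | m == (k.1 + k.2)%MM)
     a k.1 * b k.2.

Let trunc d a : {mpoly K[n]} := \sum_(m : 'X_{1..n < d}) a m *: 'X_[m].

Let truncE d a m : (mdeg m < d)%N -> (trunc d a)@_m = a m.
Proof.
move=> lt_md; rewrite raddf_sum (bigD1 (BMultinom lt_md)) //= big1 => [|i ne].
  by rewrite mcoeffZ mcoeffX eqxx mulr1 addr0.
rewrite mcoeffZ mcoeffX; case: eqP => [e|_]; last by rewrite mulr0.
by case/eqP: ne; apply: val_inj.
Qed.

Let mulE d a b (p q : {mpoly K[n]}) m : (mdeg m < d)%N ->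
  (forall m', (mdeg m' < d)%N -> p@_m' = a m') ->
  (forall m', (mdeg m' < d)%N -> q@_m' = b m') ->
  series_mul a b m = (p * q)@_m.
Proof.
move=> lt_md Hp Hq; rewrite mcoeffM; apply: eq_bigr => k _.
by rewrite Hp ?Hq //; apply: leq_trans lt_md; apply: bmdeg.
Qed.

Fact series_mulA : associative series_mul.
Proof.
move=> a b c; apply: funext => m; pose d := (mdeg m).+1.
have H e := @truncE d e.
rewrite (mulE (d := d) (p := trunc d a) (q := trunc d b * trunc d c)) //.
- rewrite (mulE (d := d) (p := trunc d a * trunc d b) (q := trunc d c)) //.
    by rewrite mulrA.
  by move=> m' lt_m'; rewrite -(mulE lt_m' (H a) (H b)).
- exact: H.
- exact: H.
by move=> m' lt_m'; rewrite -(mulE lt_m' (H b) (H c)).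
Qed.

Fact series_mulC : commutative series_mul.
Proof.
move=> a b; apply: funext => m; pose d := (mdeg m).+1.
have H e := @truncE d e.
by rewrite (mulE (ltnSn _) (H a) (H b)) (mulE (ltnSn _) (H b) (H a)) mulrC.
Qed.

Fact series_mul1 : left_id series_one series_mul.
Proof.
move=> a; apply: funext => m; pose d := (mdeg m).+1.
have H e := @truncE d e.
rewrite (mulE (p := 1) (ltnSn _) _ (H a)) ?mul1r; first exact: H.
by [].
Qed.

Fact series_mulDl : left_distributive series_mul series_add.
Proof.
move=> a b c; apply: funext => m; rewrite /series_mul /series_add -big_split.
by apply: eq_bigr => k _; rewrite mulrDl.
Qed.

Fact series_one_neq0 : series_one != 0.
Proof.
apply/eqP => /(congr1 (fun a : series n K => a 0%MM)).
by rewrite /series_one /series_of_mpoly mcoeff1 eqxx => /eqP; rewrite oner_eq0.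
Qed.

HB.instance Definition _ := GRing.Zmodule_isComNzRing.Build (series n K)
  series_mulA series_mulC series_mul1 series_mulDl series_one_neq0.

Definition series_scale (x : K) a : series n K := fun m => x * a m.

Fact series_scaleA x y a :
  series_scale x (series_scale y a) = series_scale (x * y) a.
Proof. by apply: funext => m; apply: mulrA. Qed.
Fact series_scale1 : left_id 1 series_scale.
Proof. by move=> a; apply: funext => m; apply: mul1r. Qed.
Fact series_scaleDr : right_distributive series_scale +%R.
Proof. by move=> x a b; apply: funext => m; apply: mulrDr. Qed.
Fact series_scaleDl a : {morph series_scale^~ a : x y / x + y}.
Proof. by move=> x y; apply: funext => m; apply: mulrDl. Qed.

HB.instance Definition _ := GRing.Zmodule_isLmodule.Build K (series n K)
  series_scaleA series_scale1 series_scaleDr series_scaleDl.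

Fact series_scaleAl (x : K) (a b : series n K) : x *: (a * b) = x *: a * b.
Proof.
apply: funext => m; rewrite [LHS]mulr_sumr.
by apply: eq_bigr => k _; rewrite mulrA.
Qed.

HB.instance Definition _ :=
  GRing.Lmodule_isLalgebra.Build K (series n K) series_scaleAl.

Definition partial (i : 'I_n) a : series n K :=
  fun m => a (m + U_(i))%MM *+ (m i).+1.

End SeriesRing.

Variant category := formal | analytic.

(* Absolute convergence on some closed polydisc |x_i| <= r: the partial sums of
   \sum_m |a m| r^|m|  are bounded.  When K = R[i] the order of K is partial,
   and 0 < r forces r to be real. *)
Definition convergent n (K : numFieldType) (a : series n K) : Prop :=
  exists r M : K, 0 < r /\
    forall d, \sum_(m : 'X_{1..n < d}) `|a m| * r ^+ mdeg m <= M.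

(* The germs at 0: an analytic germ (real analytic over R, holomorphic over C)
   is identified with its Taylor series. *)
Definition is_germ (cat : category) n (K : numFieldType) (a : series n K) :
    Prop :=
  match cat with formal => True | analytic => convergent a end.

Definition gradient_ideal (cat : category) n (K : numFieldType)
    (f g : series n K) : Prop :=
  exists h : 'I_n -> series n K,
    (forall i, is_germ cat (h i)) /\ g = \sum_i h i * partial i f.

(* The classes of the e j span the quotient of the ring of germs by
   gradient_ideal cat f. *)
Definition finite_codimension (cat : category) n (K : numFieldType)
    (f : series n K) : Prop :=
  exists (d : nat) (e : 'I_d -> series n K),
    (forall j, is_germ cat (e j)) /\
    forall g, is_germ cat g ->
      exists c : 'I_d -> K, gradient_ideal cat f (g - \sum_j c j *: e j).

Definition quasihomogeneous n (K : numFieldType) (f : {mpoly K[n]}) : Prop :=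
  exists (w : 'I_n -> nat) (N : nat),
    (forall i, (0 < w i)%N) /\
    \sum_i (w i)%:R *: ('X_i * f^`M(i)) = N%:R *: f.

(* The differential form  \sum_I (w I) dx_I,  where
   dx_I = dx_(i_1) /\ ... /\ dx_(i_k)  for I = {i_1 < ... < i_k}; forms of
   mixed degree are allowed, and is_dform singles out the k-forms. *)
Definition dform (n : nat) (K : comNzRingType) : Type :=
  {ffun {set 'I_n} -> series n K}.
HB.instance Definition _ n K := GRing.Zmodule.on (dform n K).

Definition is_dform (cat : category) n (K : numFieldType) (k : nat)
    (w : dform n K) : Prop :=
  forall I : {set 'I_n}, is_germ cat (w I) /\ (#|I| != k -> w I = 0).

Section Forms.
Variables (n : nat) (K : comNzRingType).
Implicit Types (w v : dform n K) (I J L : {set 'I_n}).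

Definition form0 (f : series n K) : dform n K :=
  [ffun I => if I == set0 then f else 0].

(* When I and J are disjoint,  dx_I /\ dx_J = (-1)^(inversions I J) dx_(I u J) *)
Definition inversions I J : nat :=
  #|[set p : 'I_n * 'I_n | [&& p.1 \in I, p.2 \in J & (p.2 < p.1)%N]]|.

Definition wedge w v : dform n K :=
  [ffun L : {set 'I_n} => \sum_(I : {set 'I_n} | I \subset L)
     (-1) ^+ inversions I (L :\: I) * (w I * v (L :\: I))].

(* d (a dx_I) = \sum_i (d_i a) dx_i /\ dx_I *)
Definition extd w : dform n K :=
  [ffun L : {set 'I_n} => \sum_(i in L)
     (-1) ^+ inversions [set i] (L :\ i) * partial i (w (L :\ i))].

End Forms.

(* Main.v *)
From HB Require Import structures.
Require Import Defs.
From mathcomp Require Import all_boot all_order all_algebra.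
From mathcomp Require Import boolp reals mpoly.
From mathcomp Require Import ring.

(** Let g_i be the partial derivatives of f, so that df /\ - is the Koszul
    differential of (g_i).

    Finite codimension makes the powers of each coordinate linearly dependent
    modulo the Jacobian ideal; as f is weighted homogeneous, the ideal is
    homogeneous and contains some x_i^(M_i) for every i
    ([powers_in_gradient]). These n powers form a regular sequence, which makes
    the Koszul complex exact below degree n ([koszul_exact]): a k-form killed by
    df, with k < n, is df /\ b. The proof only uses interior products with
    polynomial vector fields and division by powers of the coordinates. Hence
    the sup norm of the coefficients of b is at most a constant times that of
    the given form.

    Both d and df /\ - are homogeneous for the weights of f, so alpha can be
    treated one weighted degree p at a time ([homogeneous_primitive]). Write
    alpha = df /\ b with b of degree q = p - N < p. The form db is closed and
    killed by df, because df /\ db = - d alpha = 0. By induction on the degree,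
    db = df /\ dc. Then b + df /\ c is closed, hence equal to d gamma by the
    Poincare lemma, and alpha = df /\ d gamma.

    It remains to sum the homogeneous solutions ([glue_primitives]). In the
    formal case there is nothing to check. In the analytic case the point is
    that the bound of the solution in degree p grows only geometrically with p:
    passing from b to db costs a factor proportional to q, but the primitive
    given by the Poincare lemma is the interior product with the Euler field
    divided by q. So each of the at most p steps of the induction costs
    a bounded factor, and geometric bounds on the coefficients are the same as
    convergence. *)

Set Implicit Arguments.
Unset Strict Implicit.
Unset Printing Implicit Defensive.

Import Order.TTheory GRing.Theory Num.Theory.
Local Open Scope ring_scope.

(** * Coefficients of power series, the Leibniz rule, monomials *)

Section Series.
Variables (n : nat) (K : comNzRingType).
Implicit Types (a b : series n K) (p q : {mpoly K[n]}) (m k : 'X_{1..n}).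

Lemma series_addE a b m : (a + b) m = a m + b m. Proof. by []. Qed.
Lemma series_oppE a m : (- a) m = - a m. Proof. by []. Qed.
Lemma series_zeroE m : (0 : series n K) m = 0. Proof. by []. Qed.

Lemma series_sumE I (r : seq I) (P : pred I) (F : I -> series n K) m :
  (\sum_(i <- r | P i) F i) m = \sum_(i <- r | P i) F i m.
Proof. by elim/big_rec2: _ => // i y1 y2 _ <-. Qed.

Lemma series_mulrnE a e m : (a *+ e) m = a m *+ e.
Proof. by elim: e => // e IH; rewrite !mulrS series_addE IH. Qed.

Lemma series_scaleE x a m : (x *: a) m = x * a m. Proof. by []. Qed.

Lemma series_mul_sum a b m : (a * b) m =
  \sum_(k : 'X_{1..n < (mdeg m).+1, (mdeg m).+1} | m == (k.1 + k.2)%MM)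
     a k.1 * b k.2.
Proof. by []. Qed.

(** The coefficient of degree m of a product only involves coefficients of
    degree at most mdeg m, so that identities between series can be checked on
    polynomial truncations. *)
Lemma series_mul_agree d a b p q m : (mdeg m < d)%N ->
  (forall m', (mdeg m' < d)%N -> p@_m' = a m') ->
  (forall m', (mdeg m' < d)%N -> q@_m' = b m') ->
  (a * b) m = (p * q)@_m.
Proof.
move=> lt_md Hp Hq; rewrite mcoeffM; apply: eq_bigr => k _.
by rewrite Hp ?Hq //; apply: leq_trans lt_md; apply: bmdeg.
Qed.

Definition truncation d a : {mpoly K[n]} :=
  \sum_(m : 'X_{1..n < d}) a m *: 'X_[m].

Lemma mcoeff_truncation d a m : (mdeg m < d)%N -> (truncation d a)@_m = a m.
Proof. exact: mcoeff_mpoly. Qed.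

Lemma partial_is_zmod_morphism i : zmod_morphism (@partial n K i).
Proof. by move=> a b; apply: funext => m; rewrite /partial mulrnBl. Qed.
HB.instance Definition _ i := GRing.isZmodMorphism.Build _ _ (@partial n K i)
  (partial_is_zmod_morphism i).

Lemma partial_comm i j a : partial i (partial j a) = partial j (partial i a).
Proof.
apply: funext => m; rewrite /partial -!addmA [(U_(i) + U_(j))%MM]addmC.
rewrite !mnmDE !mnm1E -!mulrnA; congr (_ *+ _).
by case: (eqVneq i j) => [-> //|ne]; rewrite !addn0 mulnC.
Qed.

Lemma partial_mul i a b :
  partial i (a * b) = partial i a * b + a * partial i b.
Proof.
apply: funext => m; pose d := (mdeg m).+2.
have lt_d : (mdeg (m + U_(i)) < d)%N by rewrite mdegD mdeg1 addn1.
have T c m' := @mcoeff_truncation d c m'.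
rewrite {1}/partial (series_mul_agree lt_d (T a) (T b)) -mcoeff_deriv mderivM.
rewrite mcoeffD series_addE; congr (_ + _); symmetry;
  apply: (@series_mul_agree (mdeg m).+1) => // m' lt_m';
  by rewrite ?mcoeff_deriv T // ?mdegD ?mdeg1 ?addn1 // ltnW.
Qed.

Definition monomial k : series n K := series_of_mpoly 'X_[k].

Lemma monomial_mulE k a m :
  (monomial k * a) m = if (k <= m)%MM then a (m - k)%MM else 0.
Proof.
have [d lt_d] : exists d, (mdeg m < d)%N by exists (mdeg m).+1.
rewrite (series_mul_agree (p := 'X_[k]) lt_d _ (@mcoeff_truncation _ a)) //.
case: ifP => [le_km|nle_km].
  rewrite -{1}(submK le_km) addmC mulrC mcoeffMX mcoeff_truncation //.
  exact: leq_ltn_trans (mdegB _ _) lt_d.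
rewrite mcoeffM big1 // => u /eqP def_m; rewrite mcoeffX.
case: eqP => [eq_k|]; last by rewrite mul0r.
by case/negP: (negbT nle_km); rewrite def_m eq_k lem_addr.
Qed.

Lemma series_of_mpolyD p q :
  series_of_mpoly (p + q) = series_of_mpoly p + series_of_mpoly q.
Proof. by apply: funext => m; rewrite /series_of_mpoly mcoeffD. Qed.

Lemma series_of_mpolyZ c p :
  series_of_mpoly (c *: p) = c *: series_of_mpoly p.
Proof. by apply: funext => m; rewrite /series_of_mpoly mcoeffZ. Qed.

Lemma partial_series_of_mpoly i p :
  partial i (series_of_mpoly p) = series_of_mpoly p^`M(i).
Proof. by apply: funext => m; rewrite /series_of_mpoly mcoeff_deriv. Qed.

Lemma series_finite_support d a : (forall m, (d <= mdeg m)%N -> a m = 0) ->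
  a = series_of_mpoly (truncation d a).
Proof.
move=> a0; apply: funext => m; rewrite /series_of_mpoly.
case: (ltnP (mdeg m) d) => [lt_md|le_dm]; first by rewrite mcoeff_truncation.
rewrite a0 // /truncation raddf_sum big1 // => k _; rewrite /= mcoeffZ mcoeffX.
case: eqP => [eq_km|]; rewrite ?mulr0 //.
by move: (bmdeg k); rewrite eq_km ltnNge le_dm.
Qed.

End Series.

(** * Exterior and interior products in coordinates *)

Section Exterior.
Variables (n : nat) (K : comNzRingType).
Implicit Types (v w : dform n K) (L : {set 'I_n}) (a b : series n K).

(** The sign in  dx_i /\ dx_L = (sign) dx_(i |: L)  for i outside L. *)
Definition esign (i : 'I_n) L : series n K := (-1) ^+ inversions [set i] L.
(** [ext i] and [contr i] are  dx_i /\ -  and the interior product with the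
    i-th coordinate vector field. *)
Definition ext i v : dform n K :=
  [ffun L : {set 'I_n} => if i \in L then esign i (L :\ i) * v (L :\ i) else 0].
Definition contr i v : dform n K :=
  [ffun L : {set 'I_n} => if i \in L then 0 else esign i L * v (i |: L)].
Definition fmul a v : dform n K := [ffun L : {set 'I_n} => a * v L].
Definition fpartial i v : dform n K := [ffun L : {set 'I_n} => partial i (v L)].

Lemma ext_is_zmod_morphism i : zmod_morphism (ext i).
Proof.
move=> v w; apply/ffunP => L; rewrite !ffunE.
by case: ifP => _; rewrite ?mulrBr // subrr.
Qed.
Lemma contr_is_zmod_morphism i : zmod_morphism (contr i).
Proof.
move=> v w; apply/ffunP => L; rewrite !ffunE.
by case: ifP => _; rewrite ?mulrBr // subrr.
Qed.
Lemma fmul_is_zmod_morphism a : zmod_morphism (fmul a).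
Proof. by move=> v w; apply/ffunP => L; rewrite !ffunE mulrBr. Qed.
Lemma fpartial_is_zmod_morphism i : zmod_morphism (fpartial i).
Proof. by move=> v w; apply/ffunP => L; rewrite !ffunE raddfB. Qed.
HB.instance Definition _ i :=
  GRing.isZmodMorphism.Build _ _ (ext i) (ext_is_zmod_morphism i).
HB.instance Definition _ i :=
  GRing.isZmodMorphism.Build _ _ (contr i) (contr_is_zmod_morphism i).
HB.instance Definition _ a :=
  GRing.isZmodMorphism.Build _ _ (fmul a) (fmul_is_zmod_morphism a).
HB.instance Definition _ i :=
  GRing.isZmodMorphism.Build _ _ (fpartial i) (fpartial_is_zmod_morphism i).

Lemma inversions1 i L : inversions [set i] L = #|[set j in L | (j < i)%N]|.
Proof.
have inj_i : injective (pair i : 'I_n -> 'I_n * 'I_n) by move=> j1 j2 [].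
rewrite /inversions -(card_imset _ inj_i).
apply: eq_card => -[i' j]; rewrite !inE /=; apply/idP/imsetP.
  by case/and3P => /eqP -> Lj lt; exists j; rewrite // inE Lj.
by case=> k; rewrite inE => /andP [Lk lt] [-> ->]; rewrite eqxx Lk.
Qed.

Lemma esign_rem i j L : i \in L ->
  esign j L = (-1) ^+ (i < j)%N * esign j (L :\ i).
Proof.
move=> Li; rewrite /esign -exprD; congr (_ ^+ _).
rewrite !inversions1 (cardsD1 i) inE Li /=; congr (_ + _)%N.
by apply: eq_card => k; rewrite !inE; case: (k == i).
Qed.

Lemma sign_ltnC (i j : 'I_n) : i != j ->
  (-1) ^+ (i < j)%N = - (-1) ^+ (j < i)%N :> series n K.
Proof.
move=> ne; case: (ltngtP (i : nat) j) => [||/val_inj e].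
- by rewrite expr0 expr1.
- by rewrite expr0 expr1 opprK.
by rewrite e eqxx in ne.
Qed.

Lemma esign_sq i L : esign i L * esign i L = 1.
Proof. by rewrite /esign -expr2 sqrr_sign. Qed.

(** Removing i then j, or j then i, from a set that contains both changes
    exactly one of the two signs, since one of i, j precedes the other. *)
Lemma ext_anticomm i j v : ext i (ext j v) = - ext j (ext i v).
Proof.
apply/ffunP => L; rewrite !ffunE !inE.
case: (eqVneq i j) => [->|ne].
  by rewrite /= mulr0 !if_same oppr0.
rewrite /=.
case: (boolP (i \in L)) => Li; case: (boolP (j \in L)) => Lj;
  rewrite ?mulr0 ?oppr0 //.
have -> : L :\ j :\ i = L :\ i :\ j by apply/setP => k; rewrite !inE andbCA.
rewrite (esign_rem (i := j) i (L := L :\ i)) ?inE 1?eq_sym ?ne //.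
rewrite (esign_rem (i := i) j (L := L :\ j)) ?inE ?ne //.
have -> : L :\ j :\ i = L :\ i :\ j by apply/setP => k; rewrite !inE andbCA.
rewrite (sign_ltnC (i := j)) 1?eq_sym //; ring.
Qed.

(** The Clifford relation between exterior and interior products, from which
    the Koszul homotopy and Cartan's formula both follow by summation. *)
Lemma contr_ext i j v :
  contr j (ext i v) = (if i == j then v else 0) - ext i (contr j v).
Proof.
apply/ffunP => L; rewrite !ffunE !inE.
case: (eqVneq i j) => [->|ne].
  rewrite /=; case: (boolP (j \in L)) => Lj.
    by rewrite setD1K // mulrA esign_sq mul1r subrr.
  rewrite subr0 setU1K //; by rewrite mulrA esign_sq mul1r.
rewrite ffunE /=.
case: (boolP (i \in L)) => Li; case: (boolP (j \in L)) => Lj;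
  rewrite ?mulr0 ?subr0 ?sub0r ?oppr0 //.
have -> : (j |: L) :\ i = j |: (L :\ i).
  apply/setP => k; rewrite !inE; case: eqP => [->|] //=; by rewrite (negbTE ne).
rewrite (esign_rem (i := i) j (L := L)) //.
rewrite (esign_rem (i := j) i (L := j |: L :\ i)) ?inE ?eqxx //.
rewrite setU1K ?inE ?(negbTE Lj) ?andbF //.
rewrite (sign_ltnC (i := i)) // -[_ * esign i _ * _]mulrA mulrACA.
by rewrite mulNr -expr2 sqrr_sign mulN1r [in RHS]mulrCA.
Qed.

Lemma ext_fmul i a v : ext i (fmul a v) = fmul a (ext i v).
Proof.
by apply/ffunP => L; rewrite !ffunE; case: ifP; rewrite ?mulr0 // mulrCA.
Qed.

Lemma contr_fmul i a v : contr i (fmul a v) = fmul a (contr i v).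
Proof.
by apply/ffunP => L; rewrite !ffunE; case: ifP; rewrite ?mulr0 // mulrCA.
Qed.

Lemma fmul_fmul a b v : fmul a (fmul b v) = fmul (a * b) v.
Proof. by apply/ffunP => L; rewrite !ffunE mulrA. Qed.

Lemma fmulC a b v : fmul a (fmul b v) = fmul b (fmul a v).
Proof. by rewrite !fmul_fmul mulrC. Qed.

Lemma partial_sign i k a : partial i ((-1) ^+ k * a) = (-1) ^+ k * partial i a.
Proof.
rewrite -signr_odd; case: odd; rewrite ?expr0 ?expr1 ?mul1r ?mulN1r //.
by rewrite raddfN.
Qed.

Lemma ext_fpartial i j v : ext i (fpartial j v) = fpartial j (ext i v).
Proof.
by apply/ffunP => L; rewrite !ffunE; case: ifP; rewrite ?raddf0 // partial_sign.
Qed.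

Lemma contr_fpartial i j v : contr i (fpartial j v) = fpartial j (contr i v).
Proof.
by apply/ffunP => L; rewrite !ffunE; case: ifP; rewrite ?raddf0 // partial_sign.
Qed.

Lemma fpartial_comm i j v : fpartial i (fpartial j v) = fpartial j (fpartial i v).
Proof. by apply/ffunP => L; rewrite !ffunE partial_comm. Qed.

Lemma fpartial_fmul i a v :
  fpartial i (fmul a v) = fmul (partial i a) v + fmul a (fpartial i v).
Proof. by apply/ffunP => L; rewrite !ffunE partial_mul. Qed.

Lemma extd_sum v : extd v = \sum_i ext i (fpartial i v).
Proof.
apply/ffunP => L; rewrite sum_ffunE ffunE big_mkcond; apply: eq_bigr => i _.
by rewrite !ffunE.
Qed.

(** The exterior product by the 1-form of coefficients g, and the interior
    product with the vector field of components h. *)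
Definition ewedge (g : 'I_n -> series n K) v : dform n K :=
  \sum_i fmul (g i) (ext i v).
Definition icontr (h : 'I_n -> series n K) v : dform n K :=
  \sum_i fmul (h i) (contr i v).

Lemma extd_form0 a L :
  extd (form0 a) L = \sum_i (if L == [set i] then partial i a else 0).
Proof.
rewrite ffunE big_mkcond; apply: eq_bigr => i _.
case: (eqVneq L [set i]) => [->|ne].
  rewrite inE eqxx setDv ffunE eqxx inversions1.
  rewrite (_ : [set _ in _ | _] = set0) ?cards0 ?mul1r //.
  by apply/setP => j; rewrite !inE.
case: ifP => // Li; rewrite ffunE.
case: eqP => [L0|_]; last by rewrite raddf0 mulr0.
by case/eqP: ne; rewrite -(setD1K Li) L0 setU0.
Qed.

Lemma wedge_extd_form0 a v :
  wedge (extd (form0 a)) v = ewedge (fun i => partial i a) v.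
Proof.
apply/ffunP => L; rewrite sum_ffunE ffunE.
under eq_bigr => I _ do rewrite extd_form0 mulr_suml mulr_sumr.
rewrite exchange_big; apply: eq_bigr => i _ /=.
rewrite !ffunE; case: ifP => Li; last first.
  rewrite mulr0 big1 // => I /subsetP sIL.
  case: eqP => [eqI|]; last by rewrite mul0r mulr0.
  by move: (sIL i); rewrite eqI inE eqxx Li => /(_ isT).
rewrite (bigD1 [set i]) ?sub1set //= eqxx big1 ?addr0 => [|I /andP [_ /negbTE ->]].
  by rewrite mulrCA.
by rewrite mul0r mulr0.
Qed.

Lemma ewedge_is_zmod_morphism g : zmod_morphism (ewedge g).
Proof.
by move=> v w; rewrite /ewedge -sumrB; apply: eq_bigr => i _; rewrite !raddfB.
Qed.
Lemma icontr_is_zmod_morphism h : zmod_morphism (icontr h).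
Proof.
by move=> v w; rewrite /icontr -sumrB; apply: eq_bigr => i _; rewrite !raddfB.
Qed.
Lemma extd_is_zmod_morphism : zmod_morphism (@extd n K).
Proof.
by move=> v w; rewrite !extd_sum -sumrB; apply: eq_bigr => i _; rewrite !raddfB.
Qed.
HB.instance Definition _ g :=
  GRing.isZmodMorphism.Build _ _ (ewedge g) (ewedge_is_zmod_morphism g).
HB.instance Definition _ h :=
  GRing.isZmodMorphism.Build _ _ (icontr h) (icontr_is_zmod_morphism h).
HB.instance Definition _ :=
  GRing.isZmodMorphism.Build _ _ (@extd n K) extd_is_zmod_morphism.

Lemma ewedge_fmul g a v : ewedge g (fmul a v) = fmul a (ewedge g v).
Proof.
rewrite /ewedge raddf_sum; apply: eq_bigr => i _ /=.
by rewrite ext_fmul fmulC.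
Qed.

Lemma fmul_suml I (r : seq I) (P : pred I) (F : I -> series n K) v :
  fmul (\sum_(i <- r | P i) F i) v = \sum_(i <- r | P i) fmul (F i) v.
Proof.
apply/ffunP => L; rewrite sum_ffunE ffunE mulr_suml.
by apply: eq_bigr => i _; rewrite ffunE.
Qed.

Lemma icontr_ewedge g h v :
  icontr h (ewedge g v) = fmul (\sum_i h i * g i) v - ewedge g (icontr h v).
Proof.
rewrite /icontr /ewedge fmul_suml.
under [X in _ = _ - X]eq_bigr => i _ do rewrite !raddf_sum /=.
rewrite [X in _ = _ - X]exchange_big -sumrB; apply: eq_bigr => j _ /=.
rewrite !raddf_sum /= (eq_bigr (fun i => fmul (h j * g i) (if i == j then v else 0)
   - fmul (h j * g i) (ext i (contr j v)))); last first.
  by move=> i _; rewrite contr_fmul contr_ext fmul_fmul raddfB.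
rewrite sumrB (bigD1 j) //= eqxx big1 ?addr0 => [|i /negbTE ->]; last first.
  by rewrite raddf0.
congr (_ + _); rewrite -sumrN; apply: eq_bigr => i _; congr (- _).
by rewrite ext_fmul fmul_fmul mulrC.
Qed.

End Exterior.

(** * The algebra of d and of the exterior product by df *)

Section Identities.
Variables (n : nat) (K : numFieldType).
Implicit Types (v w : dform n K) (L : {set 'I_n}) (a b : series n K).

Lemma antisym_sum0 (F : 'I_n -> 'I_n -> dform n K) :
  (forall i j, F i j = - F j i) -> \sum_i \sum_j F i j = 0.
Proof.
move=> antiF; set S := \sum_i _.
have SN : S = - S.
  rewrite {1}/S exchange_big -sumrN; apply: eq_bigr => i _.
  by rewrite -sumrN; apply: eq_bigr => j _.
apply/ffunP => L; apply: funext => m; rewrite ffunE series_zeroE.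
have /(congr1 (fun v : dform n K => v L m)) := SN.
rewrite ffunE series_oppE => /eqP; rewrite -subr_eq0 opprK -mulr2n mulrn_eq0.
by move/eqP.
Qed.

Lemma ewedge_ewedge (g : 'I_n -> series n K) v : ewedge g (ewedge g v) = 0.
Proof.
rewrite /ewedge.
under eq_bigr => i _ do rewrite !raddf_sum /=.
apply: antisym_sum0 => i j.
by rewrite !ext_fmul ext_anticomm !raddfN /= fmulC.
Qed.

Lemma extd_extd v : extd (extd v) = 0.
Proof.
rewrite !extd_sum.
under eq_bigr => i _ do rewrite !raddf_sum /=.
apply: antisym_sum0 => i j.
by rewrite -!ext_fpartial ext_anticomm fpartial_comm.
Qed.

Lemma extd_ewedge a v : extd (ewedge (fun i => partial i a) v) =
  - ewedge (fun i => partial i a) (extd v).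
Proof.
rewrite !extd_sum /ewedge.
under eq_bigr => i _ do rewrite !raddf_sum /=.
under [X in _ = - X]eq_bigr => i _ do rewrite !raddf_sum /=.
rewrite [X in _ = - X]exchange_big -sumrN.
under [RHS]eq_bigr => i _ do rewrite -sumrN.
apply/eqP; rewrite -subr_eq0 -sumrB; apply/eqP.
under eq_bigr => i _ do rewrite -sumrB.
rewrite -[RHS](@antisym_sum0 (fun i j =>
  fmul (partial i (partial j a)) (ext i (ext j v)))) => [|i j].
  apply: eq_bigr => i _; apply: eq_bigr => j _.
  rewrite fpartial_fmul raddfD /= !ext_fmul -ext_fpartial.
  by rewrite (ext_anticomm i j (fpartial _ _)) raddfN /= opprK addrNK.
by rewrite partial_comm ext_anticomm raddfN.
Qed.

Lemma ext_contrE i v L : ext i (contr i v) L = if i \in L then v L else 0.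
Proof.
rewrite !ffunE; case: ifP => // Li.
by rewrite !inE eqxx /= setD1K // mulrA esign_sq mul1r.
Qed.

End Identities.

(** * Weighted degrees and Cartan's formula for the Euler field *)

Section Grading.
Variables (n : nat) (K : numFieldType) (w : 'I_n -> nat).
Implicit Types (u v : dform n K) (L : {set 'I_n}) (a b g : series n K).
Implicit Types (m k : 'X_{1..n}) (P : pred nat).

(** In [fwdeg] the differential dx_i has the same weight w_i as x_i, so that d
    preserves the weighted degree of forms. *)
Definition wdeg m : nat := \sum_i w i * m i.
Definition fwdeg L m : nat := wdeg m + \sum_(i in L) w i.

Lemma wdegD m k : wdeg (m + k) = (wdeg m + wdeg k)%N.
Proof.
by rewrite /wdeg -big_split; apply: eq_bigr => i _; rewrite mnmDE mulnDr.
Qed.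

Lemma wdegU i : wdeg U_(i) = w i.
Proof.
rewrite /wdeg (bigD1 i) //= mnm1E eqxx muln1 big1 ?addn0 // => j /negbTE ne.
by rewrite mnm1E eq_sym ne muln0.
Qed.

Lemma fwdeg_rem i L m : i \in L -> fwdeg L m = (fwdeg (L :\ i) m + w i)%N.
Proof. by move=> Li; rewrite /fwdeg (big_setD1 i Li) /= addnCA addnC. Qed.

(** The i-th component of the field W = sum_i w_i x_i d/dx_i. *)
Definition euler i : series n K := monomial K U_(i) *+ w i.

Lemma euler_partial i a m : (euler i * partial i a) m = a m *+ (w i * m i).
Proof.
rewrite /euler mulrnAl -scaler_nat [LHS]mulr_natl monomial_mulE mulrnA mulrnAC.
congr (_ *+ _); case: ifP => [le_im|].
  rewrite /partial submK // mnmBE mnm1E eqxx subn1 prednK //.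
  by move/mnm_lepP/(_ i): le_im; rewrite mnm1E eqxx.
rewrite lep1mP => /negbFE /eqP ->; by rewrite mulr0n.
Qed.

Lemma partial_euler i j : partial i (euler j) = if i == j then (w i)%:R else 0.
Proof.
rewrite /euler raddfMn /= /monomial partial_series_of_mpoly mderivX mnm1E eq_sym.
case: eqP => [->|_].
  rewrite (_ : _ - _ = 0)%MM ?mpolyX0 ?scale1r //.
  by apply/mnmP => k; rewrite mnmBE subnn mnm0E.
rewrite scale0r; apply: funext => m.
by rewrite series_mulrnE /series_of_mpoly mcoeff0 mul0rn.
Qed.

(** Cartan's formula for the Lie derivative along W, which multiplies each
    term  x^m dx_L  by its weighted degree. *)
Lemma cartan v L m :
  (extd (icontr euler v) + icontr euler (extd v)) L m = v L m *+ fwdeg L m.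
Proof.
have -> : extd (icontr euler v) + icontr euler (extd v) =
    \sum_i (fmul (w i)%:R (ext i (contr i v)) + fmul (euler i) (fpartial i v)).
  rewrite !extd_sum /icontr.
  under eq_bigr => i _ do rewrite !raddf_sum /=.
  under [X in _ + X]eq_bigr => i _ do rewrite !raddf_sum /=.
  rewrite [X in _ + X]exchange_big -big_split; apply: eq_bigr => i _ /=.
  rewrite -big_split /= (eq_bigr (fun j => if i == j then
     fmul (w i)%:R (ext i (contr i v)) + fmul (euler i) (fpartial i v) else 0)).
    by rewrite -big_mkcond /= (big_pred1 i) // => j; rewrite eq_sym.
  move=> j _; rewrite fpartial_fmul raddfD /= !ext_fmul contr_ext partial_euler.
  rewrite raddfB /= contr_fpartial; case: (eqVneq i j) => [<-|ne].
    by rewrite addrA addrAC addrK.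
  rewrite raddf0 add0r addrK.
  by apply/ffunP => I; rewrite !ffunE mul0r.
rewrite sum_ffunE series_sumE /fwdeg /wdeg addnC mulrnDr -!sumrMnr.
rewrite [X in _ = X + _]big_mkcond.
rewrite -big_split; apply: eq_bigr => i _ /=.
rewrite ffunE series_addE [fmul _ (ext _ _) _]ffunE [fmul (euler i) _ _]ffunE.
rewrite [fpartial _ _ _]ffunE euler_partial ext_contrE; congr (_ + _).
case: ifP => _; last by rewrite mulr0.
by rewrite mulr_natl series_mulrnE.
Qed.

Definition restrict (Q : pred 'X_{1..n}) a : series n K :=
  fun m => if Q m then a m else 0.

(** Multiplication by a homogeneous series shifts degrees; this covers all the
    compatibilities between products and the extraction of homogeneous
    components. *)
Lemma mul_restrict (Q R : pred 'X_{1..n}) g a :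
  (forall k m, g k != 0 -> Q m = R (k + m)%MM) ->
  g * restrict Q a = restrict R (g * a).
Proof.
move=> QR; apply: funext => m; rewrite /restrict !series_mul_sum.
case: ifP => Rm; last rewrite big1 //; last first.
  move=> k /eqP def_m; case: (eqVneq (g k.1) 0) => [->|/QR]; first by rewrite mul0r.
  by move->; rewrite -def_m Rm mulr0.
apply: eq_bigr => k /eqP def_m.
case: (eqVneq (g k.1) 0) => [->|/QR]; first by rewrite !mul0r.
by move->; rewrite -def_m Rm.
Qed.

Lemma sign_mulE (e : nat) a m : ((-1) ^+ e * a) m = (-1) ^+ e * a m.
Proof.
rewrite -signr_odd -[in RHS]signr_odd.
by case: odd; rewrite ?expr0 ?mul1r ?expr1 ?mulN1r.
Qed.

Definition cut P v : dform n K :=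
  [ffun L : {set 'I_n} => restrict (fun m => P (fwdeg L m)) (v L)].

Lemma cutE P v L m : cut P v L m = if P (fwdeg L m) then v L m else 0.
Proof. by rewrite ffunE. Qed.

Lemma cut0 P : cut P 0 = 0.
Proof.
by apply/ffunP => L; apply: funext => m; rewrite cutE ffunE if_same.
Qed.

Lemma cut_extd P v : cut P (extd v) = extd (cut P v).
Proof.
apply/ffunP => L; apply: funext => m; rewrite cutE !ffunE !series_sumE.
have E i : i \in L -> fwdeg (L :\ i) (m + U_(i)) = fwdeg L m.
  move=> Li; rewrite (fwdeg_rem m Li) /fwdeg wdegD wdegU -addnA.
  by rewrite [(w i + _)%N]addnC addnA.
case: ifP => Pm.
  apply: eq_bigr => i Li; rewrite !sign_mulE; congr (_ * _).
  by rewrite /partial cutE E ?Pm.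
by rewrite big1 // => i Li; rewrite sign_mulE /partial cutE E ?Pm // mul0rn mulr0.
Qed.

(** The form of coefficients g has weighted degree N when each g_i has weighted
    degree N - w_i. Selecting degrees by a predicate P, shifted by N, avoids the
    subtraction q - N. *)
Lemma cut_ewedge P N (g : 'I_n -> series n K) v :
  (forall i m, g i m != 0 -> (wdeg m + w i = N)%N) ->
  cut P (ewedge g v) = ewedge g (cut (fun q => P (q + N)%N) v).
Proof.
move=> homg; apply/ffunP => L; rewrite ffunE !sum_ffunE.
apply: funext => m; rewrite /restrict !series_sumE.
have E i : i \in L ->
    g i * restrict (fun m => P (fwdeg (L :\ i) m + N)%N) (v (L :\ i)) =
    restrict (fun m => P (fwdeg L m)) (g i * v (L :\ i)).
  move=> Li; apply: mul_restrict => k m' /homg <-; congr (P _).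
  by rewrite (fwdeg_rem _ Li) /fwdeg wdegD addnACA (addnC (wdeg m')) !addnA.
have F i : fmul (g i) (ext i (cut (fun q => P (q + N)%N) v)) L m =
   if P (fwdeg L m) then fmul (g i) (ext i v) L m else 0.
  rewrite !ffunE; case: ifP => Li; last by rewrite mulr0 if_same.
  rewrite mulrCA sign_mulE E // mulrCA sign_mulE /restrict.
  by case: ifP => //; rewrite mulr0.
by rewrite (eq_bigr _ (fun i _ => F i)); case: ifP => // _; rewrite big1.
Qed.

Definition supported P v := forall L m, ~~ P (fwdeg L m) -> v L m = 0.

Lemma supported_cut P v : supported P (cut P v).
Proof. by move=> L m /negbTE; rewrite cutE => ->. Qed.

Lemma cut_id P v : supported P v -> cut P v = v.
Proof.
move=> hv; apply/ffunP => L; apply: funext => m; rewrite cutE.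
by case: ifP => // /negbT /hv.
Qed.

Lemma supported_extd P v : supported P v -> supported P (extd v).
Proof. by move/cut_id <-; rewrite -cut_extd; apply: supported_cut. Qed.

Lemma supportedD P u v : supported P u -> supported P v -> supported P (u + v).
Proof. by move=> hu hv L m ne; rewrite ffunE series_addE hu ?hv ?addr0. Qed.

Lemma supported_ewedge P N (g : 'I_n -> series n K) v :
  (forall i m, g i m != 0 -> (wdeg m + w i = N)%N) ->
  supported (fun q => P (q + N)%N) v -> supported P (ewedge g v).
Proof.
by move=> homg /cut_id <-; rewrite -(cut_ewedge P _ homg); apply: supported_cut.
Qed.

Lemma euler_support i k : euler i k != 0 -> k = U_(i)%MM.
Proof.
apply: contra_neq_eq => ne; rewrite /euler.
by rewrite series_mulrnE /monomial /series_of_mpoly mcoeffX eq_sym (negbTE ne) mul0rn.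
Qed.

Lemma supported_icontr P v : supported P v -> supported P (icontr euler v).
Proof.
move=> hv L m ne; rewrite sum_ffunE series_sumE big1 // => i _.
rewrite !ffunE; case: ifP => Li; first by rewrite mulr0.
rewrite mulrCA sign_mulE series_mul_sum big1 ?mulr0 // => k /eqP def_m.
case: (eqVneq (euler i k.1) 0) => [->|/euler_support def_k]; first by rewrite mul0r.
rewrite hv ?mulr0 //; apply: contra ne; congr (is_true (P _)).
rewrite (fwdeg_rem _ (setU11 i L)) setU1K ?Li // /fwdeg.
rewrite [wdeg m](congr1 wdeg def_m) wdegD def_k wdegU.
by rewrite addnC addnA.
Qed.

End Grading.

(** * Degrees of forms *)

Section Degree.
Variables (n : nat) (K : numFieldType).
Implicit Types (u v : dform n K) (L : {set 'I_n}) (g h : 'I_n -> series n K).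

Definition kform k v := forall L, #|L| != k -> v L = 0.

Lemma kform_extd k v : kform k v -> kform k.+1 (extd v).
Proof.
move=> hv L ne; rewrite ffunE big1 // => i Li; rewrite hv ?raddf0 ?mulr0 //.
by apply: contra ne => /eqP <-; rewrite (cardsD1 i L) Li.
Qed.

Lemma kform_ewedge g k v : kform k v -> kform k.+1 (ewedge g v).
Proof.
move=> hv L ne; rewrite sum_ffunE big1 // => i _; rewrite !ffunE.
case: ifP => Li; rewrite ?mulr0 // hv ?mulr0 //.
by apply: contra ne => /eqP <-; rewrite (cardsD1 i L) Li.
Qed.

Lemma kform_icontr h k v : kform k.+1 v -> kform k (icontr h v).
Proof.
move=> hv L ne; rewrite sum_ffunE big1 // => i _; rewrite !ffunE.
case: ifP => Li; rewrite ?mulr0 // hv ?mulr0 //.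
by rewrite cardsU1 Li add1n eqSS.
Qed.

Lemma icontr_kform0 h v : kform 0 v -> icontr h v = 0.
Proof.
move=> hv; apply/ffunP => L; rewrite sum_ffunE big1 ?ffunE // => i _.
by rewrite !ffunE; case: ifP => Li; rewrite ?mulr0 // hv ?mulr0 // cardsU1 Li.
Qed.

Lemma kformD k u v : kform k u -> kform k v -> kform k (u + v).
Proof. by move=> hu hv L ne; rewrite ffunE hu ?hv ?addr0. Qed.

End Degree.

(** * Operators that are bounded for the sup norm of the coefficients *)

Section Bounds.
Variables (n : nat) (K : numFieldType).
Implicit Types (u v : dform n K) (L : {set 'I_n}) (a b : series n K).
Implicit Types (g h : 'I_n -> series n K) (c d : K).

Definition sbounded c a := forall m, `|a m| <= c.
Definition fbounded c v := forall L, sbounded c (v L).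

Lemma fbounded_ge0 c v : fbounded c v -> 0 <= c.
Proof. by move=> /(_ set0 0%MM); apply: le_trans; apply: normr_ge0. Qed.

Lemma fboundedD c d u v :
  fbounded c u -> fbounded d v -> fbounded (c + d) (u + v).
Proof.
move=> hu hv L m; rewrite ffunE series_addE.
by apply: le_trans (ler_normD _ _) _; apply: lerD; [apply: hu | apply: hv].
Qed.

Lemma fboundedN c v : fbounded c v -> fbounded c (- v).
Proof. by move=> hv L m; rewrite ffunE series_oppE normrN; apply: hv. Qed.

Lemma fbounded_sum (F : 'I_n -> dform n K) (C : 'I_n -> K) :
  (forall i, fbounded (C i) (F i)) -> fbounded (\sum_i C i) (\sum_i F i).
Proof.
move=> hF L m; rewrite sum_ffunE series_sumE.
apply: le_trans (ler_norm_sum _ _ _) _.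
by apply: ler_sum => i _; apply: hF.
Qed.

(** Polynomials have this property for the l^1 norm H of their coefficients.
    The constant is the same in all degrees, which is what makes the final
    estimate geometric. *)
Definition bounded_mul a := exists H : K, 0 <= H /\
  forall b c, sbounded c b -> sbounded (H * c) (a * b).

Lemma bounded_mul_mpoly (p : {mpoly K[n]}) : bounded_mul (series_of_mpoly p).
Proof.
elim/mpolyind: p => [|x k p _ _ [H [H0 IH]]].
  exists 0; split=> // b c _ m; rewrite (_ : series_of_mpoly 0 = 0); last first.
    by apply: funext => k; rewrite /series_of_mpoly mcoeff0.
  by rewrite !mul0r normr0.
exists (`|x| + H); split=> [|b c hb m]; first by rewrite addr_ge0.
rewrite series_of_mpolyD series_of_mpolyZ mulrDl -scalerAl series_addE mulrDl.
apply: le_trans (ler_normD _ _) _; apply: lerD; last exact: IH.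
rewrite series_scaleE -/(monomial K k) normrM; apply: ler_wpM2l => //; rewrite monomial_mulE.
by case: ifP => _ //; rewrite normr0; apply: le_trans (hb 0%MM).
Qed.

Lemma normr_sign_mul e a m : `|((-1) ^+ e * a) m| = `|a m|.
Proof. by rewrite sign_mulE normrM normrX normrN1 expr1n mul1r. Qed.

Lemma fbounded_ext i c v : fbounded c v -> fbounded c (ext i v).
Proof.
move=> hv L m; rewrite ffunE; case: ifP => _.
  by rewrite normr_sign_mul; apply: hv.
by rewrite series_zeroE normr0 (fbounded_ge0 hv).
Qed.

Lemma fbounded_contr i c v : fbounded c v -> fbounded c (contr i v).
Proof.
move=> hv L m; rewrite ffunE; case: ifP => _; last first.
  by rewrite normr_sign_mul; apply: hv.
by rewrite series_zeroE normr0 (fbounded_ge0 hv).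
Qed.

Definition bounded_op (T : dform n K -> dform n K) := exists C : K, 0 <= C /\
  forall v c, fbounded c v -> fbounded (C * c) (T v).

Lemma bounded_op_sum g (E : 'I_n -> dform n K -> dform n K) :
  (forall i, bounded_mul (g i)) ->
  (forall i c v, fbounded c v -> fbounded c (E i v)) ->
  bounded_op (fun v => \sum_i fmul (g i) (E i v)).
Proof.
move=> /choice [H hH] hE; exists (\sum_i H i); split=> [|v c hv].
  by rewrite sumr_ge0 // => i _; case: (hH i).
rewrite mulr_suml; apply: fbounded_sum => i L; rewrite ffunE.
by case: (hH i) => _; apply; apply: hE.
Qed.

Lemma bounded_op_ewedge g :
  (forall i, bounded_mul (g i)) -> bounded_op (ewedge g).
Proof. by move=> hg; apply: bounded_op_sum => // *; apply: fbounded_ext. Qed.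

Lemma bounded_op_icontr h :
  (forall i, bounded_mul (h i)) -> bounded_op (icontr h).
Proof. by move=> hh; apply: bounded_op_sum => // *; apply: fbounded_contr. Qed.

End Bounds.

(** * Forms modulo the first powers of the coordinates *)

Section Division.
Variables (n : nat) (K : numFieldType) (M : 'I_n -> nat).
Implicit Types (u v : dform n K) (L : {set 'I_n}) (a b : series n K).

Definition reduced (q : nat) (m : 'X_{1..n}) :=
  [forall i : 'I_n, (i < q)%N ==> (m i < M i)%N].
(** The forms with coefficients in the ideal generated by the x_i^(M i), i < q:
    as this ideal is monomial, membership is read on the support. *)
Definition power_ideal q v := forall L m, reduced q m -> v L m = 0.

Lemma power_idealD q u v :
  power_ideal q u -> power_ideal q v -> power_ideal q (u + v).
Proof. by move=> hu hv L m rm; rewrite ffunE series_addE hu ?hv ?addr0. Qed.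

Lemma power_idealN q v : power_ideal q v -> power_ideal q (- v).
Proof. by move=> hv L m rm; rewrite ffunE series_oppE hv ?oppr0. Qed.

Lemma power_ideal_sum q (F : 'I_n -> dform n K) :
  (forall i, power_ideal q (F i)) -> power_ideal q (\sum_i F i).
Proof.
by move=> hF L m rm; rewrite sum_ffunE series_sumE big1 // => i _; apply: hF.
Qed.

Lemma power_ideal_fmul q a v : power_ideal q v -> power_ideal q (fmul a v).
Proof.
move=> hv L m /forallP rm; rewrite ffunE series_mul_sum big1 // => k /eqP def_m.
rewrite hv ?mulr0 //; apply/forallP => i; apply/implyP => lt_iq.
have := implyP (rm i) lt_iq; apply: leq_ltn_trans.
have -> : m i = (k.1 + k.2)%MM i by exact: (congr1 (fun m' : 'X_{1..n} => m' i) def_m).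
by rewrite mnmDE leq_addl.
Qed.

Lemma power_ideal_ewedge q g v : power_ideal q v -> power_ideal q (ewedge g v).
Proof.
move=> hv; apply: power_ideal_sum => i; apply: power_ideal_fmul => L m rm.
by rewrite ffunE; case: ifP => _ //; rewrite sign_mulE hv ?mulr0.
Qed.

Lemma power_ideal_icontr q h v : power_ideal q v -> power_ideal q (icontr h v).
Proof.
move=> hv; apply: power_ideal_sum => i; apply: power_ideal_fmul => L m rm.
by rewrite ffunE; case: ifP => _ //; rewrite sign_mulE hv ?mulr0.
Qed.

Variables (i : 'I_n).
Let y : series n K := monomial K (U_(i) *+ M i).

Lemma lep_power m : (U_(i) *+ M i <= m)%MM = (M i <= m i)%N.
Proof.
apply/mnm_lepP/idP => [/(_ i)|le j]; rewrite mulmnE mnm1E ?eqxx ?mul1n //.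
by case: eqP => [<-|]; rewrite ?mul1n ?mul0n.
Qed.

Lemma reducedS m : reduced i.+1 m = reduced i m && (m i < M i)%N.
Proof.
apply/forallP/andP => [rm|[/forallP rm lt] j].
  split; last exact: (implyP (rm i)).
  by apply/forallP => j; apply/implyP => lt; apply: (implyP (rm j)); apply: ltnW.
apply/implyP; rewrite ltnS leq_eqVlt => /orP [/eqP /val_inj -> //|].
exact: (implyP (rm j)).
Qed.

Lemma power_idealS v : power_ideal i v -> power_ideal i.+1 v.
Proof. by move=> hv L m; rewrite reducedS => /andP [rm _]; apply: hv. Qed.

(** x_i^(M i) is regular modulo the powers of the previous coordinates:
    multiplying by it does not change the exponents of these coordinates. *)
Lemma power_ideal_cancel v : power_ideal i (fmul y v) -> power_ideal i v.
Proof.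
move=> hv L m rm; have := hv L (m + U_(i) *+ M i)%MM.
rewrite ffunE monomial_mulE lep_power mnmDE mulmnE mnm1E eqxx mul1n leq_addl.
rewrite addmK; apply; apply/forallP => j; apply/implyP => lt_ji.
rewrite mnmDE mulmnE mnm1E [i == j]eq_sym -val_eqE /= (ltn_eqF lt_ji) addn0.
exact: (implyP (forallP rm j)).
Qed.

Lemma power_ideal_fmul_power v : power_ideal i.+1 (fmul y v).
Proof.
move=> L m; rewrite reducedS => /andP [_ lt].
by rewrite ffunE monomial_mulE lep_power leqNgt lt.
Qed.

(** The quotient by x_i^(M i) in the division that leaves a remainder of degree
    less than M i in x_i. Its coefficients are among those of v, hence the
    division is bounded with constant 1. *)
Definition fquo v : dform n K :=
  [ffun L : {set 'I_n} => fun m => v L (m + U_(i) *+ M i)%MM].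

Lemma power_ideal_rem v :
  power_ideal i.+1 v -> power_ideal i (v - fmul y (fquo v)).
Proof.
move=> hv L m rm; rewrite ffunE series_addE ffunE series_oppE ffunE.
rewrite monomial_mulE; case: ifP => le_m; first by rewrite ffunE submK ?subrr.
by rewrite subr0 hv // reducedS rm ltnNge -lep_power le_m.
Qed.

End Division.

(** * Exactness of the Koszul complex, with bounds *)

Section Koszul.
Variables (n : nat) (K : numFieldType) (M : 'I_n -> nat).
Variables (g : 'I_n -> series n K) (h : 'I_n -> 'I_n -> series n K).
Hypothesis power_eq :
  forall i, monomial K (U_(i) *+ M i) = \sum_j h i j * g j.
Hypothesis g_bounded : forall j, bounded_mul (g j).
Hypothesis h_bounded : forall i j, bounded_mul (h i j).

(** Exactness in degree k of the Koszul complex of g modulo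
    y_j = x_j^(M j), j < q. Let y = y_q. Since y is a combination of the g_j,
    interior product with the coefficients of this combination is a homotopy
    from multiplication by y to 0: y v = iota (g v) + g (iota v). Hence iota v
    is a cocycle modulo y_0, ..., y_q, of degree one less, and by induction
    iota v = g u + y u' modulo the y_j, j < q. Then y v = y (g u') and y
    cancels. In degree 0 the homotopy formula reads y v = 0. The room needed for all
    these y's is q + k < n. Every step is a bounded operator, so u' is bounded
    linearly in terms of v. *)
Lemma koszul_division k q : (q + k < n)%N -> exists C : K, 0 <= C /\
  forall v : dform n K, kform k v -> power_ideal M q (ewedge g v) ->
  exists u : dform n K, [/\ forall L : {set 'I_n}, #|L|.+1 != k -> u L = 0,
    power_ideal M q (v - ewedge g u)
  & forall c, fbounded c v -> fbounded (C * c) u].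
Proof.
elim: k q => [|k IH] q lt_n.
  rewrite addn0 in lt_n; pose i := Ordinal lt_n.
  exists 0; split=> // v hv wv; exists 0; split=> [L _|| c _ L m].
  - by rewrite ffunE.
  - rewrite raddf0 subr0; apply: (@power_ideal_cancel _ _ M i).
    have := icontr_ewedge g (h i) v.
    rewrite -power_eq (icontr_kform0 _ hv) raddf0 subr0 => <-.
    exact: power_ideal_icontr.
  by rewrite ffunE normr0 mul0r.
have lt_q : (q < n)%N by apply: leq_trans lt_n; rewrite ltnS leq_addr.
pose i := Ordinal lt_q.
have [|CE [CE0 hE]] := @IH q.+1; first by rewrite addSnnS.
have [CD [CD0 hD]] := bounded_op_ewedge g_bounded.
have [CI [CI0 hI]] := bounded_op_icontr (h_bounded i).
(* This bounds iota v - g u, hence its quotient by y. *)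
exists (CI + CD * CE * CI); split=> [|v hv wv].
  by rewrite addr_ge0 ?mulr_ge0.
pose y := monomial K (U_(i) *+ M i).
have def_yv : fmul y v = icontr (h i) (ewedge g v) + ewedge g (icontr (h i) v).
  by rewrite icontr_ewedge -power_eq addrNK.
have [|u [hu ideal_u bu]] := hE _ (kform_icontr (h i) hv).
  rewrite -[ewedge g _](addKr (icontr (h i) (ewedge g v))) -def_yv addrC.
  apply: power_idealD; first exact: (@power_ideal_fmul_power _ _ M i).
  apply/power_idealN/(@power_idealS _ _ M i).
  exact: power_ideal_icontr.
pose r := icontr (h i) v - ewedge g u.
exists (fquo M i r); split=> [L ne||c bv].
- rewrite ffunE; apply: funext => m; rewrite ffunE series_addE ffunE series_oppE.
  rewrite (kform_icontr (h i) hv) // sum_ffunE big1 ?subr0 // => j _.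
  rewrite !ffunE; case: ifP => Lj; rewrite ?mulr0 // hu ?mulr0 //.
  by apply: contra ne => /eqP <-; rewrite (cardsD1 j L) Lj.
- apply: (@power_ideal_cancel _ _ M i); rewrite raddfB /= def_yv -ewedge_fmul.
  have [s def_s] : exists s, s = r - fmul y (fquo M i r) by eexists.
  have -> : icontr (h i) v = s + fmul y (fquo M i r) + ewedge g u.
    by rewrite def_s !addrNK.
  rewrite !raddfD /= ewedge_ewedge addr0 addrA addrK.
  apply: power_idealD; first exact: power_ideal_icontr.
  apply: power_ideal_ewedge; rewrite def_s.
  exact: (@power_ideal_rem _ _ M i).
rewrite mulrDl -!mulrA => L m; rewrite ffunE.
suff: fbounded (CI * c + CD * (CE * (CI * c))) r by apply.
by apply: fboundedD; [apply: hI | apply/fboundedN/hD/bu/hI].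
Qed.

Lemma koszul_exact k : (k < n)%N -> exists C : K, 0 <= C /\
  forall v : dform n K, kform k v -> ewedge g v = 0 ->
  exists u : dform n K, [/\ forall L : {set 'I_n}, #|L|.+1 != k -> u L = 0,
    v = ewedge g u & forall c, fbounded c v -> fbounded (C * c) u].
Proof.
move=> lt_kn; have [//|C [C0 hC]] := @koszul_division k 0.
exists C; split=> // v hv wv.
have [|u [hu ideal_u bu]] := hC v hv; first by rewrite wv => L m _; rewrite ffunE.
exists u; split=> //; apply/eqP; rewrite -subr_eq0; apply/eqP/ffunP => L.
by apply: funext => m; rewrite ideal_u ?ffunE //; apply/forallP.
Qed.

End Koszul.

(** * The homogeneous case: induction on the weighted degree *)

Section Poincare.
Variables (n : nat) (K : numFieldType) (w : 'I_n -> nat).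
Implicit Types (u v : dform n K) (L : {set 'I_n}) (x c : K).

Definition fscale x v : dform n K := [ffun L : {set 'I_n} => x *: v L].

Lemma fscaleE x v L m : fscale x v L m = x * v L m.
Proof. by rewrite ffunE. Qed.

Lemma extd_fscale x v : extd (fscale x v) = fscale x (extd v).
Proof.
apply/ffunP => L; apply: funext => m; rewrite fscaleE !ffunE !series_sumE mulr_sumr.
apply: eq_bigr => i _; rewrite !sign_mulE mulrCA; congr (_ * _).
by rewrite /partial fscaleE mulrnAr.
Qed.

Lemma fbounded_fscale x c v : 0 <= x -> fbounded c v ->
  fbounded (x * c) (fscale x v).
Proof.
move=> x0 hv L m; rewrite fscaleE normrM ger0_norm //.
by apply: ler_wpM2l => //; apply: hv.
Qed.

(** The Poincare lemma, in the form given by the Euler field. The factor 1/q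
    is essential for convergence. *)
Lemma poincare q v : (0 < q)%N -> supported w (pred1 q) v -> extd v = 0 ->
  extd (fscale q%:R^-1 (icontr (euler K w) v)) = v.
Proof.
move=> q0 hv dv; apply/ffunP => L; apply: funext => m.
rewrite extd_fscale fscaleE; have := cartan w v L m.
rewrite dv raddf0 addr0 => ->; case: (eqVneq (fwdeg w L m) q) => [->|ne].
  by rewrite -[v L m *+ _]mulr_natl mulKf // pnatr_eq0 -lt0n.
by rewrite hv // mul0rn mulr0.
Qed.

Lemma bounded_mul_euler i : bounded_mul (euler K w i).
Proof.
suff -> : euler K w i = series_of_mpoly ((w i)%:R *: 'X_[U_(i)]).
  exact: bounded_mul_mpoly.
by rewrite series_of_mpolyZ scaler_nat.
Qed.

Hypothesis w_gt0 : forall i, (0 < w i)%N.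

(** On forms of weighted degree q the exponents that appear are at most q, so
    a derivative costs a factor q. *)
Lemma fbounded_extd q c v : supported w (pred1 q) v -> fbounded c v ->
  fbounded ((n * q)%:R * c) (extd v).
Proof.
move=> hv bv; rewrite extd_sum natrM -mulrA -[n in n%:R]card_ord.
rewrite mulr_natl -sumr_const; apply: fbounded_sum => i; apply: fbounded_ext => L m.
rewrite ffunE /partial normrMn -[leLHS]mulr_natl.
case: (eqVneq (fwdeg w L (m + U_(i))) q) => [Lm|ne]; last first.
  by rewrite hv //= normr0 mulr0 mulr_ge0 ?(fbounded_ge0 bv).
apply: ler_pM => //; last exact: bv.
rewrite ler_nat -Lm /fwdeg /wdeg (bigD1 i) //= -addnA.
apply: leq_trans (leq_addr _ _).
by rewrite mnmDE mnm1E eqxx addn1 -{1}[(m i).+1]mul1n leq_mul2r w_gt0 orbT.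
Qed.

Lemma fwdeg_gt0 L m : (0 < #|L|)%N -> (0 < fwdeg w L m)%N.
Proof.
case/card_gt0P => i Li; rewrite (fwdeg_rem _ _ Li).
by rewrite addn_gt0 w_gt0 orbT.
Qed.

Variables (a : series n K) (N k : nat).
Hypotheses (N_gt0 : (0 < N)%N) (a_homog : forall m, a m != 0 -> wdeg w m = N).
Let g i := partial i a.
Hypotheses (g_bounded : forall i, bounded_mul (g i)).
Variable C1 : K.
Hypothesis C1_ge0 : 0 <= C1.
Hypothesis koszul : forall v, kform k.+2 v -> ewedge g v = 0 ->
  exists u : dform n K, [/\ forall L, #|L|.+1 != k.+2 -> u L = 0,
    v = ewedge g u & forall c, fbounded c v -> fbounded (C1 * c) u].

Lemma g_homog i m : g i m != 0 -> (wdeg w m + w i = N)%N.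
Proof.
rewrite /g /partial mulrn_eq0 negb_or /= => /a_homog <-.
by rewrite wdegD wdegU.
Qed.

(** Write v = df /\ b with b of degree q = p - N. Then db is closed, is killed
    by df since df /\ db = - dv, and has lower degree: by induction
    db = df /\ du'. So z = b + df /\ u' is closed, z = du by the Poincare lemma,
    and v = df /\ z = df /\ du. The factor q lost in the bound of db is regained
    in the Poincare lemma, so each induction step multiplies the bound by a
    constant C and the total constant is at most C^p. *)
Lemma homogeneous_primitive : exists C : K, 0 <= C /\
  forall p v, supported w (pred1 p) v -> kform k.+2 v -> extd v = 0 ->
  ewedge g v = 0 -> exists u,
  [/\ kform k u, supported w (fun q => q + N == p)%N u, v = ewedge g (extd u)
    & forall c, fbounded c v -> fbounded (C ^+ p * c) u].
Proof.
have [CD [CD0 hD]] := bounded_op_ewedge g_bounded.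
have [CE [CE0 hE]] := bounded_op_icontr bounded_mul_euler.
pose C := 1 + CE * C1 * (1 + CD * n%:R).
have C_ge1 : 1 <= C by rewrite lerDl !mulr_ge0 // addr_ge0 // mulr_ge0.
have C0 : 0 <= C by apply: le_trans C_ge1.
exists C; split=> // p; elim/ltn_ind: p => p IH v hv kv dv gv.
have [b0 [kb0 def_v bb0]] := koszul kv gv.
pose b := cut w (fun q => q + N == p)%N b0.
have {}def_v : v = ewedge g b.
  rewrite -(cut_id hv) def_v (@cut_ewedge _ _ w _ N) //; exact: g_homog.
have kb : kform k.+1 b.
  move=> L ne; rewrite ffunE kb0 ?eqSS //.
  by apply: funext => m; rewrite /restrict if_same.
have sb : supported w (fun q => q + N == p)%N b by apply: supported_cut.
have bb c : fbounded c v -> fbounded (C1 * c) b.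
  move=> bv L m; rewrite cutE; case: ifP => _; first exact: bb0.
  by rewrite normr0 mulr_ge0 // (fbounded_ge0 bv).
(* b is a (k+1)-form, so its terms have positive weighted degree. *)
have [le_pN | lt_Np] := leqP p N.
  have zeroE L m : (0 : dform n K) L m = 0 by rewrite ffunE.
  have b_0 : b = 0.
    apply/ffunP => L; apply: funext => m; rewrite zeroE.
    have [/eqP cL|/kb -> //] := boolP (#|L| == k.+1).
    rewrite sb // neq_ltn; apply/orP; right; apply: leq_ltn_trans le_pN _.
    by rewrite -[X in (X < _)%N]add0n ltn_add2r fwdeg_gt0 // cL.
  exists 0; split=> [L _|L m _||c bv L m]; first by rewrite ffunE.
  - exact: zeroE.
  - by rewrite def_v b_0 !raddf0.
  by rewrite zeroE normr0 mulr_ge0 ?exprn_ge0 // (fbounded_ge0 bv).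
have [q def_p] : exists q, p = (q + N)%N by exists (p - N)%N; rewrite subnK // ltnW.
have q_gt0 : (0 < q)%N by rewrite -(ltn_add2r N) add0n -def_p.
have lt_qp : (q < p)%N by rewrite def_p -[X in (X < _)%N]addn0 ltn_add2l.
have {}sb : supported w (pred1 q) b.
  by move=> L m ne; apply: sb; rewrite def_p eqn_add2r.
have gdb : ewedge g (extd b) = 0.
  by apply/eqP; rewrite -oppr_eq0 -extd_ewedge -def_v dv.
have [u' [ku' su' def_db bu']] :=
  IH q lt_qp _ (supported_extd sb) (kform_extd kb) (extd_extd b) gdb.
pose z := b + ewedge g u'.
have sz : supported w (pred1 q) z.
  by apply: supportedD => //; apply: supported_ewedge su'; apply: g_homog.
have kz : kform k.+1 z by apply: kformD => //; apply: kform_ewedge.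
have dz : extd z = 0 by rewrite raddfD /= extd_ewedge -def_db subrr.
exists (fscale q%:R^-1 (icontr (euler K w) z)); split.
- move=> L ne; rewrite ffunE (kform_icontr _ kz) //.
  by apply: funext => m; apply: mulr0.
- move=> L m ne; rewrite fscaleE (supported_icontr sz) ?mulr0 //.
  by rewrite def_p eqn_add2r in ne.
- by rewrite poincare // raddfD /= ewedge_ewedge addr0.
move=> c bv; have c0 := fbounded_ge0 bv.
have {}bu' := bu' _ (fbounded_extd sb (bb _ bv)).
have qV0 : 0 <= q%:R^-1 :> K by rewrite invr_ge0 ler0n.
have bz := fbounded_fscale qV0 (hE _ _ (fboundedD (bb _ bv) (hD _ _ bu'))).
move=> L m; apply: le_trans (bz L m) _.
have q0 : 0 < q%:R :> K by rewrite ltr0n.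
apply: (@le_trans _ _ (C ^+ q.+1 * c)); last first.
  by apply: ler_wpM2r => //; apply: ler_weXn2l.
rewrite mulrC ler_pdivrMr // natrM.
have -> : CE * (C1 * c + CD * (C ^+ q * (n%:R * q%:R * (C1 * c)))) =
  (CE * C1 + q%:R * (CE * C1 * CD * n%:R * C ^+ q)) * c by ring.
rewrite [leRHS]mulrAC; apply: ler_wpM2r => //.
apply: (@le_trans _ _ (q%:R * (CE * C1 * C ^+ q + CE * C1 * CD * n%:R * C ^+ q))).
  rewrite [leRHS]mulrDr lerD2r mulrCA -[leLHS]mulr1; apply: ler_wpM2l.
    by rewrite mulr_ge0.
  by rewrite -[leLHS]mul1r; apply: ler_pM => //; rewrite ?ler1n ?exprn_ege1.
rewrite mulrC; apply: ler_wpM2r => //; rewrite exprSr -mulrDl mulrC.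
apply: ler_wpM2l; rewrite ?exprn_ge0 // /C mulrDr mulr1 !mulrA.
by rewrite -[leLHS]add0r lerD2r.
Qed.

End Poincare.

(** * Convergent series are those with geometrically bounded coefficients *)

Section Convergence.
Variables (n : nat) (K : numFieldType).
Implicit Types (a : series n K).

Lemma leq_mdeg (m : 'X_{1..n}) i : (m i <= mdeg m)%N.
Proof. by rewrite mdegE (bigD1 i) //= leq_addr. Qed.

(** The sum is part of the expansion of the n-th power of
    1 + 1/2 + ... + 1/2^(d-1). *)
Lemma sum_half_pow d :
  \sum_(m : 'X_{1..n < d}) (2^-1 : K) ^+ mdeg m <= 2 ^+ n.
Proof.
set x : K := 2^-1; have x0 : 0 <= x by rewrite invr_ge0.
have lt_md (m : 'X_{1..n < d}) i : (m i < d)%N.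
  exact: leq_ltn_trans (leq_mdeg m i) (bmdeg m).
pose phi (m : 'X_{1..n < d}) : {ffun 'I_n -> 'I_d} :=
  [ffun i => Ordinal (lt_md m i)].
have phi_inj : injective phi.
  move=> m1 m2 /ffunP eq_phi; apply/val_inj/mnmP => i.
  by have := congr1 val (eq_phi i); rewrite !ffunE.
pose F (s : {ffun 'I_n -> 'I_d}) : K := \prod_i x ^+ s i.
have F0 s : 0 <= F s by rewrite prodr_ge0 // => i _; rewrite exprn_ge0.
apply: (@le_trans _ _ (\sum_s F s)).
  rewrite (eq_bigr (fun m => F (phi m))) => [|m _]; last first.
    by rewrite mdegE expr_sum; apply: eq_bigr => i _; rewrite ffunE.
  have -> : \sum_(m : 'X_{1..n < d}) F (phi m) = \sum_(s in phi @: setT) F s.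
    rewrite big_imset => [|m1 m2 _ _ /phi_inj //].
    by apply: eq_bigl => m; rewrite inE.
  by rewrite [leRHS](bigID (mem (phi @: setT))) /= lerDl sumr_ge0.
rewrite -(bigA_distr_bigA (fun _ (j : 'I_d) => x ^+ j)) /=.
have geom : \sum_(j < d) x ^+ j + 2 * x ^+ d = 2.
  have x2 : 2 * x = 1 by rewrite mulfV ?pnatr_eq0.
  elim: d {lt_md phi phi_inj F F0} => [|d IH].
    by rewrite big_ord0 add0r expr0 mulr1.
  rewrite big_ord_recr /= exprS mulrA x2 mul1r -addrA.
  rewrite -mulr2n -[x ^+ d *+ 2]mulr_natl.
  exact: IH.
apply: (@le_trans _ _ (\prod_(i < n) 2)); last by rewrite prodr_const card_ord.
apply: ler_prod => i _; rewrite sumr_ge0 => [|j _]; last exact: exprn_ge0.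
by rewrite -[leRHS]geom lerDl mulr_ge0 ?exprn_ge0.
Qed.

Lemma convergent_bound a : convergent a ->
  exists A r : K, [/\ 0 <= A, 0 <= r & forall m, `|a m| <= A * r ^+ mdeg m].
Proof.
case=> r [A [r0 hA]]; have r_ge0 := ltW r0; exists A, r^-1; split; last move=> m.
- apply: le_trans (hA 0%N); rewrite sumr_ge0 // => m _.
  by rewrite mulr_ge0 ?exprn_ge0.
- by rewrite invr_ge0.
rewrite exprVn ler_pdivlMr ?exprn_gt0 //; apply: le_trans (hA (mdeg m).+1).
rewrite (bigD1 (BMultinom (ltnSn (mdeg m)))) //= lerDl sumr_ge0 // => k _.
by rewrite mulr_ge0 ?exprn_ge0.
Qed.

Lemma bound_convergent a (A r : K) : 0 <= A -> 1 <= r ->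
  (forall m, `|a m| <= A * r ^+ mdeg m) -> convergent a.
Proof.
move=> A0 r1 ha; have r0 : 0 < r by apply: lt_le_trans r1.
exists (2^-1 / r), (A * 2 ^+ n); split=> [|d]; first by rewrite divr_gt0 ?invr_gt0.
apply: le_trans (ler_wpM2l A0 (sum_half_pow d)); rewrite mulr_sumr.
apply: ler_sum => m _; rewrite expr_div_n mulrCA mulrC.
apply: ler_wpM2r; first by rewrite exprn_ge0 ?invr_ge0.
by rewrite ler_pdivrMr ?exprn_gt0.
Qed.

Lemma germ_monomial cat k : is_germ cat (monomial K k : series n K).
Proof.
case: cat => //=; apply: (@bound_convergent _ 1 1) => // m.
rewrite expr1n mulr1 /monomial /series_of_mpoly mcoeffX.
by case: (_ == _); rewrite ?normr1 ?normr0.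
Qed.

End Convergence.

(** * Powers of the coordinates in the Jacobian ideal *)

Section Jacobian.
Variables (n : nat) (K : numFieldType) (w : 'I_n -> nat) (N : nat).
Variable f : {mpoly K[n]}.
Hypothesis w_gt0 : forall i, (0 < w i)%N.
Let F := series_of_mpoly f.

Lemma series_of_mpolyM (p q : {mpoly K[n]}) :
  series_of_mpoly (p * q) = series_of_mpoly p * series_of_mpoly q.
Proof. by apply: funext => m; rewrite /series_of_mpoly mcoeffM. Qed.

(** On the monomial x^m the Euler field acts by the scalar wdeg m. *)
Lemma quasihomogeneous_support :
  \sum_i (w i)%:R *: ('X_i * f^`M(i)) = N%:R *: f ->
  forall m, F m != 0 -> wdeg w m = N.
Proof.
move=> eq_f m Fm; have := congr1 (mcoeff m) eq_f.
rewrite mcoeffZ raddf_sum /= (eq_bigr (fun i => F m *+ (w i * m i))) => [|i _].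
  rewrite sumrMnr -/(wdeg w m) => eq_m; apply/eqP; rewrite -(eqr_nat K).
  by apply/eqP/(mulIf Fm); rewrite mulr_natl.
rewrite -euler_partial /euler mulrnAl mcoeffZ mulr_natl.
by rewrite series_mulrnE partial_series_of_mpoly -series_of_mpolyM.
Qed.

Hypothesis F_homog : forall m, F m != 0 -> wdeg w m = N.
Let g i := partial i F.

Lemma leq_wdeg (m : 'X_{1..n}) : (mdeg m <= wdeg w m)%N.
Proof. by rewrite mdegE /wdeg; apply: leq_sum => i _; rewrite leq_pmull. Qed.

Lemma wdeg_power i s : wdeg w (U_(i) *+ s)%MM = (s * w i)%N.
Proof.
elim: s => [|s IH]; last by rewrite mulmS wdegD wdegU IH.
by rewrite mulm0n /wdeg big1 // => j _; rewrite mnm0E muln0.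
Qed.

Lemma monomialE (k m : 'X_{1..n}) : monomial K k m = (k == m)%:R.
Proof. exact: mcoeffX. Qed.

(** The d + 1 powers 1, x_i, ..., x_i^d are linearly dependent in a quotient
    spanned by d classes. *)
Lemma power_combination cat i : finite_codimension cat F ->
  exists d (c : 'I_d -> K) (H : 'I_n -> series n K), (exists s, c s != 0) /\
    \sum_s c s *: monomial K (U_(i) *+ s) = \sum_t H t * g t.
Proof.
case=> d [e [_ span_e]].
have /choice [c /choice [H hH]] : forall s : 'I_d.+1, exists (c : 'I_d -> K),
    exists H : 'I_n -> series n K,
    monomial K (U_(i) *+ s) - \sum_j c j *: e j = \sum_t H t * g t.
  move=> s; case: (span_e _ (germ_monomial K cat (U_(i) *+ s))) => c [H [_ eqH]].
  by exists c, H.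
pose A : 'M[K]_(d.+1, d) := \matrix_(s, j) c s j.
have : kermx A != 0.
  rewrite kermx_eq0 /row_free; apply: contraL (rank_leq_col A) => /eqP ->.
  by rewrite ltnn.
case/rowV0Pn => l /sub_kermxP lA l0.
exists d.+1, (l 0), (fun t => \sum_s l 0 s *: H s t); split.
  by case/rV0Pn: l0 => s ls; exists s.
transitivity (\sum_s l 0 s *: \sum_t H s t * g t).
  have lc j : \sum_s l 0 s * c s j = 0.
    have /matrixP/(_ 0 j) := lA; rewrite !mxE => eq0; rewrite -[RHS]eq0.
    by apply: eq_bigr => s _; rewrite mxE.
  under [RHS]eq_bigr => s _ do rewrite -hH scalerBr scaler_sumr.
  rewrite sumrB exchange_big /= [X in _ - X]big1 ?subr0 // => j _.
  under eq_bigr => s _ do rewrite scalerA.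
  by rewrite -scaler_suml lc scale0r.
under eq_bigr => s _ do rewrite scaler_sumr.
rewrite exchange_big; apply: eq_bigr => t _ /=.
by rewrite mulr_suml; apply: eq_bigr => s _; rewrite scalerAl.
Qed.

Lemma restrictE Q (a : series n K) m : restrict Q a m = if Q m then a m else 0.
Proof. by []. Qed.

(** The Jacobian ideal is homogeneous and the powers of x_i have distinct
    weighted degrees, so any power with nonzero coefficient in a linear
    combination that belongs to the ideal belongs to it as well. Its
    coefficients h can be taken homogeneous, hence polynomial, even when the
    original ones were series. *)
Lemma power_in_gradient cat i : finite_codimension cat F ->
  exists (s : nat) (h : 'I_n -> series n K), (forall t, bounded_mul (h t)) /\
    monomial K (U_(i) *+ s) = \sum_t h t * g t.
Proof.
move/(@power_combination _ i) => [d [c [H [[s cs] eqH]]]].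
pose Q (m : 'X_{1..n}) := wdeg w m == (s * w i)%N.
pose Qt t (m : 'X_{1..n}) := (wdeg w m + N == s * w i + w t)%N.
exists s, (fun t => (c s)^-1 *: restrict (Qt t) (H t)); split=> [t|].
  pose d0 := (s * w i + w t).+1.
  rewrite (@series_finite_support _ _ d0 (_ *: restrict _ _)).
    exact: bounded_mul_mpoly.
  move=> m lt_m; rewrite series_scaleE restrictE /Qt gtn_eqF ?mulr0 //.
  exact: leq_trans lt_m (leq_trans (leq_wdeg m) (leq_addr _ _)).
under eq_bigr => t _ do rewrite -scalerAl.
rewrite -scaler_sumr.
have -> : \sum_t restrict (Qt t) (H t) * g t = restrict Q (\sum_t H t * g t).
  apply: funext => m; rewrite restrictE !series_sumE -(big_mkcond xpredT) /=.
  transitivity (\sum_t restrict Q (H t * g t) m); last first.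
    by rewrite /restrict; case: ifP => // _; rewrite big1.
  apply: eq_bigr => t _; rewrite mulrC [H t * _]mulrC.
  rewrite (@mul_restrict _ _ (Qt t) Q) // => k m' /(g_homog F_homog) gk.
  by rewrite /Q /Qt wdegD -gk -[in RHS](eqn_add2r (w t)) addnCA addnA.
rewrite -eqH; apply: funext => m.
rewrite series_scaleE restrictE series_sumE; have [em|ne] := eqVneq (U_(i) *+ s)%MM m.
  rewrite (bigD1 s) //= big1 => [|s' ne].
    by rewrite series_scaleE monomialE em /Q -em wdeg_power !eqxx addr0 mulr1 mulVf.
  rewrite series_scaleE monomialE -em; case: eqP => [|_]; last by rewrite mulr0.
  move/(congr1 (fun m : 'X_{1..n} => m i)); rewrite !mulmnE mnm1E eqxx !mul1n.
  by move/val_inj => es; rewrite es eqxx in ne.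
rewrite monomialE (negbTE ne); case: ifP => [/eqP wm|]; last by rewrite mulr0.
rewrite big1 ?mulr0 // => s' _; rewrite series_scaleE monomialE.
case: eqP => [em|_]; last by rewrite mulr0.
move: wm; rewrite -em wdeg_power => /eqP; rewrite eqn_pmul2r // => /eqP es.
by rewrite -em es eqxx in ne.
Qed.

(** If N were 0, positivity of the weights would force all partial derivatives
    to vanish, and no power of a coordinate would lie in the ideal. *)
Lemma powers_in_gradient cat : (0 < n)%N -> finite_codimension cat F ->
  (0 < N)%N /\ exists (M : 'I_n -> nat) (h : 'I_n -> 'I_n -> series n K),
    (forall i t, bounded_mul (h i t)) /\
    (forall i, monomial K (U_(i) *+ M i) = \sum_t h i t * g t).
Proof.
move=> n_gt0 fc.
have /choice [M /choice [h hh]] : forall i, exists s (h : 'I_n -> series n K),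
    (forall t, bounded_mul (h t)) /\ monomial K (U_(i) *+ s) = \sum_t h t * g t.
  by move=> i; apply: power_in_gradient fc.
split; last first.
  by exists M, h; split=> i; [move=> t|]; case: (hh i) => // + _; apply.
rewrite lt0n; apply/eqP => N0; pose i := Ordinal n_gt0.
have [_ /(congr1 (fun a : series n K => a (U_(i) *+ M i)%MM))] := hh i.
rewrite monomialE eqxx series_sumE big1 => [/eqP|t _]; first by rewrite oner_eq0.
rewrite (_ : g t = 0) ?mulr0 //; apply: funext => m; apply/eqP.
apply: contraT => /(g_homog F_homog) /eqP.
by rewrite N0 addn_eq0 (gtn_eqF (w_gt0 t)) andbF.
Qed.

End Jacobian.

(** * Summing the homogeneous primitives *)

Section Assembly.
Variables (n : nat) (K : numFieldType) (w : 'I_n -> nat) (N k : nat).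
Hypothesis w_gt0 : forall i, (0 < w i)%N.
Variable g : 'I_n -> series n K.
Hypothesis g_homog : forall i m, g i m != 0 -> (wdeg w m + w i = N)%N.
Variable C : K.
Hypothesis C_ge0 : 0 <= C.

Lemma fwdeg_bound (L : {set 'I_n}) m :
  (fwdeg w L m <= (\sum_i w i) * (mdeg m).+1)%N.
Proof.
rewrite mulnS addnC /fwdeg; apply: leq_add.
  rewrite /wdeg big_distrl; apply: leq_sum => i _ /=.
  by rewrite leq_mul2l leq_mdeg orbT.
by rewrite [leqRHS](bigID (mem L)) /= leq_addr.
Qed.

(** In the analytic case the component of degree p of v is bounded by A r^p,
    so its primitive is bounded by A (C r)^p; and p is at most affine in the
    degree of the monomial. *)
Lemma germ_glue cat (v u : dform n K) (up : nat -> dform n K) :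
  (forall L, is_germ cat (v L)) ->
  (forall p c, fbounded c (cut w (pred1 p) v) -> fbounded (C ^+ p * c) (up p)) ->
  (forall L m, u L m = up (fwdeg w L m + N)%N L m) ->
  forall L, is_germ cat (u L).
Proof.
case: cat => //= hv hup def_u L.
have /choice [A /choice [r hAr]] := fun L => convergent_bound (hv L).
pose A' := \sum_L A L; pose r' := 1 + \sum_L r L.
have A0 : 0 <= A' by rewrite sumr_ge0 // => I _; case: (hAr I).
have r1 : 1 <= r' by rewrite lerDl sumr_ge0 // => I _; case: (hAr I).
have r0 : 0 <= r' by apply: le_trans r1.
have bv p : fbounded (A' * r' ^+ p) (cut w (pred1 p) v).
  move=> I m; rewrite cutE /=; case: eqP => [fp|_]; last first.
    by rewrite normr0 mulr_ge0 // exprn_ge0.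
  have [AI rI hI] := hAr I; apply: le_trans (hI m) _.
  apply: ler_pM => //; first exact: exprn_ge0.
    rewrite /A' (bigD1 I) //= lerDl sumr_ge0 // => J _.
    by case: (hAr J).
  apply: (@le_trans _ _ (r' ^+ mdeg m)).
    apply: lerXn2r; rewrite ?nnegrE //.
    rewrite /r' (bigD1 I) //= addrCA lerDl addr_ge0 // sumr_ge0 // => J _.
    by case: (hAr J).
  apply: ler_weXn2l => //; rewrite -fp.
  exact: leq_trans (leq_wdeg w_gt0 m) (leq_addr _ _).
pose D := (1 + C) * r'; pose B := (\sum_i w i)%N.
have D1 : 1 <= D by rewrite -[leLHS]mul1r; apply: ler_pM => //; rewrite lerDl.
have D0 : 0 <= D by apply: le_trans D1.
apply: (@bound_convergent _ _ _ (A' * D ^+ (B + N)) (D ^+ B)).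
- by rewrite mulr_ge0 // exprn_ge0.
- exact: exprn_ege1.
move=> m; rewrite def_u; set p := (fwdeg w L m + N)%N.
apply: le_trans (hup p _ (bv p) L m) _.
rewrite mulrCA -exprMn -mulrA; apply: ler_wpM2l => //.
apply: (@le_trans _ _ (D ^+ p)).
  apply: lerXn2r; rewrite ?nnegrE // ?mulr_ge0 //.
  by rewrite /D; apply: ler_wpM2r => //; rewrite lerDr.
rewrite -exprM -exprD; apply: ler_weXn2l => //.
rewrite /p addnAC leq_add2r -mulnS; exact: fwdeg_bound.
Qed.

Lemma glue_primitives cat (v : dform n K) :
  (forall p v', supported w (pred1 p) v' -> kform k.+2 v' -> extd v' = 0 ->
    ewedge g v' = 0 -> exists u : dform n K,
    [/\ kform k u, supported w (fun q => q + N == p)%N u, v' = ewedge g (extd u)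
      & forall c, fbounded c v' -> fbounded (C ^+ p * c) u]) ->
  is_dform cat k.+2 v -> extd v = 0 -> ewedge g v = 0 ->
  exists u : dform n K, is_dform cat k u /\ v = ewedge g (extd u).
Proof.
move=> prim hv dv gv.
have /choice [up hup] : forall p, exists u : dform n K,
    [/\ kform k u, supported w (fun q => q + N == p)%N u,
        cut w (pred1 p) v = ewedge g (extd u)
      & forall c, fbounded c (cut w (pred1 p) v) -> fbounded (C ^+ p * c) u].
  move=> p; apply: prim.
  - exact: supported_cut.
  - move=> L ne; rewrite ffunE; case: (hv L) => _ -> //.
    by apply: funext => m; rewrite /restrict if_same.
  - by rewrite -cut_extd dv cut0.
  have cutN : cut w (pred1 p) v = cut w (fun q => q + N == p + N)%N v.
    by apply/ffunP => L; apply: funext => m; rewrite !cutE eqn_add2r.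
  by rewrite cutN -(cut_ewedge (pred1 (p + N)%N) _ g_homog) gv cut0.
pose u : dform n K :=
  [ffun L : {set 'I_n} => fun m => up (fwdeg w L m + N)%N L m].
have uE L m : u L m = up (fwdeg w L m + N)%N L m by rewrite ffunE.
have cut_u p : cut w (fun q => q + N == p)%N u = up p.
  have [_ sup _ _] := hup p; rewrite -[RHS](cut_id sup).
  apply/ffunP => L; apply: funext => m; rewrite !cutE uE.
  by case: eqP => // ->.
exists u; split=> [L|]; first split.
- apply: (@germ_glue cat v u up) L => [L|p|]; last exact: uE.
    by case: (hv L).
  by case: (hup p).
- move=> ne; apply: funext => m; rewrite uE.
  by case: (hup (fwdeg w L m + N)%N) => ku _ _ _; rewrite ku.
apply/ffunP => L; apply: funext => m; pose p := fwdeg w L m.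
have [_ _ def_v _] := hup p.
have := congr1 (fun v' : dform n K => v' L m) def_v.
rewrite -cut_u -cut_extd -(cut_ewedge (pred1 p) _ g_homog) !cutE /= /p eqxx.
by [].
Qed.

End Assembly.

Theorem proposition3p4 (R : realType) (b : ground) (cat : category)
    (n k : nat) (f : {mpoly (ground_field R b)[n]})
    (alpha : dform n (ground_field R b)) :
  (3 <= n)%N ->
  quasihomogeneous f ->
  f.@[fun _ => 0] = 0 ->
  finite_codimension cat (series_of_mpoly f) ->
  (2 <= k <= n - 1)%N ->
  is_dform cat k alpha ->
  extd alpha = 0 ->
  wedge (extd (form0 (series_of_mpoly f))) alpha = 0 ->
  exists gamma : dform n (ground_field R b),
    is_dform cat (k - 2) gamma /\
    alpha = wedge (extd (form0 (series_of_mpoly f))) (extd gamma).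
Proof.
move=> le3n [w [N [w_gt0 eq_f]]] _ fc /andP [le2k le_kn] ha da ga.
have n_gt0 : (0 < n)%N by apply: leq_trans le3n.
have lt_kn : (k < n)%N by rewrite -(prednK n_gt0) ltnS -subn1.
have F_homog := quasihomogeneous_support eq_f.
have [N_gt0 [M [h [h_bounded power_eq]]]] :=
  powers_in_gradient w_gt0 F_homog n_gt0 fc.
have [k' def_k] : exists k', k = k'.+2 by exists (k - 2)%N; rewrite -addn2 subnK.
rewrite def_k in lt_kn ha *; rewrite -addn2 addnK.
have g_bounded i : bounded_mul (partial i (series_of_mpoly f)).
  by rewrite partial_series_of_mpoly; apply: bounded_mul_mpoly.
have [C1 [C1_ge0 koszul]] := koszul_exact power_eq g_bounded h_bounded lt_kn.
have [C [C_ge0 prim]] :=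
  homogeneous_primitive w_gt0 N_gt0 F_homog g_bounded C1_ge0 koszul.
rewrite wedge_extd_form0 in ga.
have [u [hu def_a]] := glue_primitives w_gt0 (g_homog F_homog) C_ge0 prim ha da ga.
by exists u; split=> //; rewrite wedge_extd_form0.
Qed.
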